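(* Let $K\subset\mathbb{C}$ be a compactum. If $K$ is locally connected or finitely Suslinian, then $K$ satisfies the Schönflies condition.
   Context: A compactum is a compact metric space; a continuum is a connected compactum. A compactum is finitely Suslinian if every collection of pairwise disjoint subcontinua whose diameters are bounded away from zero is finite. For two parallel lines $L_1,L_2$ in the plane, $U(L_1,L_2)$ denotes the unbounded open strip bounded by them, i.e. the component of $\mathbb{C}\setminus(L_1\cup L_2)$ with boundary $L_1\cup L_2$. A compactum $K\subset\mathbb{C}$ satisfies the Schönflies condition if for any two (distinct) parallel lines $L_1,L_2$, with $U=U(L_1,L_2)$, the difference $\overline{U}\setminus K$ has at most finitely many components intersecting both $L_1$ and $L_2$. *)

(* Defs.v *)
(* MathComp / MathComp-Analysis, with the complex numbers of real-closed *)
From HB Require Import structures.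
From mathcomp Require Import all_boot all_order all_algebra.
From mathcomp Require Import all_classical all_reals all_analysis.
From mathcomp Require Import complex.

Set Implicit Arguments.
Unset Strict Implicit.
Unset Printing Implicit Defensive.

Import Order.TTheory GRing.Theory Num.Theory numFieldNormedType.Exports.

Local Open Scope classical_set_scope.
Local Open Scope ring_scope.
Local Open Scope complex_scope.

(* Seeing R[i] as a numFieldType is what gives it, by inheritance, the topology
   of the norm `|z|, i.e. the Euclidean topology. *)
Definition plane (R : realType) : numFieldType := R[i].

Section topology.
Context {T : topologicalType}.
Implicit Types A K : set T.

Definition boundary A : set T := closure A `\` A°.

Definition components A : set (set T) := connected_component A @` A.

Definition continuum A : Prop := [/\ A !=set0, compact A & connected A].

(* K is locally connected as a subspace of T: the relatively open sets of K are
   the O `&` K with O open in T. *)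
Definition locally_connected K : Prop :=
  forall x (W : set T), K x -> open W -> W x ->
    exists O : set T, [/\ open O, O x, connected (O `&` K) & O `&` K `<=` W].

End topology.

Section plane.
Context {R : realType}.
Implicit Types A K L U : set (plane R).

(* The norm on R[i] takes its values in R[i], hence the real part. The supremum
   is the diameter for nonempty bounded A, in particular for continua. *)
Definition diameter A : R :=
  sup [set complex.Re `|x - y| | x in A & y in A].

Definition finitely_suslinian K : Prop :=
  forall F : set (set (plane R)),
    (forall A, F A -> continuum A /\ A `<=` K) ->
    (forall A B, F A -> F B -> A <> B -> A `&` B = set0) ->
    (exists2 e : R, 0 < e & forall A, F A -> e <= diameter A) ->
    finite_set F.

Definition line (p v : plane R) : set (plane R) :=
  [set p + (t%:C : plane R) * v | t in [set: R]].

Definition parallel_lines L1 L2 : Prop :=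
  exists p q v : plane R, [/\ v != 0, L1 = line p v & L2 = line q v].

Definition is_strip L1 L2 U : Prop :=
  components (~` (L1 `|` L2)) U /\ boundary U = L1 `|` L2.

Definition schonflies K : Prop :=
  forall L1 L2 U, parallel_lines L1 L2 -> L1 <> L2 -> is_strip L1 L2 U ->
    finite_set [set D | [/\ components (closure U `\` K) D,
                            D `&` L1 !=set0 & D `&` L2 !=set0]].

End plane.

(* Main.v *)
Require Import Defs.
From mathcomp Require Import all_boot all_order all_algebra.
From mathcomp Require Import all_classical all_reals all_analysis.
From mathcomp Require Import finmap complex ring lra.
Import Order.TTheory GRing.Theory Num.Theory.
Import numFieldNormedType.Exports.

Set Implicit Arguments.
Unset Strict Implicit.
Unset Printing Implicit Defensive.

Local Open Scope classical_set_scope.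
Local Open Scope ring_scope.
Local Open Scope complex_scope.

(** Normalise the strip to [0 <= y <= 1] by an affine chart, and write [X] for
    the part of [K] in the closed strip. Call a component of a subset of the
    strip crossing when it meets both edges.

    Either hypothesis on [K] makes the crossing components of [X] finite in
    number. They are pairwise disjoint continua whose diameters are at least the
    width of the strip, which settles the finitely Suslinian case. If [K] is
    locally connected, each point of [K] at height 1/2 has a neighbourhood whose
    trace on [K] is connected and stays in the strip, hence lies in one
    component of [X]; finitely many such neighbourhoods cover the compact set of
    these points, and every crossing component contains one of them.

    It remains to see that a compact subset [X] of the strip with finitely many
    crossing components has a complement with finitely many crossing components
    ([finite_crossing_components]). Cut the strip down to a box whose left and
    right edges miss [X]. A crossing component [D] of the complement contains a
    crossing continuum [G]. If [C] is a connected closed set disjoint from [G],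
    then [G] separates the left edge of the box from the right edge
    ([separating_crossing]), so [C] lies away from one of the two, and [G] can
    be joined off [C] to that edge ([barrier_side]). Record, for each crossing
    component [C] of [X], whether [D] is joined to the left edge off [C]. There
    are only finitely many records, so it is enough that two complementary
    components [D] and [E] with the same record coincide. Now [D] and [E] are
    joined to each other off every component [C] of [X]: through a common edge
    of the box if [C] is crossing, and along the top or the bottom otherwise.
    But points of a convex set that are joined off every component of a compact
    set [X] are joined off [X] ([connected_off_components]), so [D = E].

    That last principle rests on two facts. Components of a compact set are
    intersections of relatively clopen subsets ([component_clopen]), so every
    point of [X] has a clopen neighbourhood in [X] off which the two points are
    joined. And points joined off each of two disjoint compact sets are joined
    off their union ([janiszewski]), so those neighbourhoods can be added up
    along a finite cover. The last fact is the vanishing of the first cohomology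
    of a convex set, and the separation property of [G] is the only place where
    the dimension 2 enters; both are proved by counting along finite chains of
    small steps, without lifting maps or approximating by polygons. *)

(** * Local-to-global principles *)

(** A transitive symmetric relation that holds locally has relatively open
    classes, and the other classes make up the complement of each, so a
    connected set is a single class. All the continuation arguments below are
    instances: small steps, locally constant integers, and joining by continua.
    *)
Lemma connected_chain (T : topologicalType) (W : set T) (E : T -> T -> Prop) :
  connected W ->
  (forall x y, E x y -> E y x) -> (forall x y z, E x y -> E y z -> E x z) ->
  (forall x, W x -> \forall y \near x, W y -> E x y) ->
  forall x y, W x -> W y -> E x y.
Proof.
move=> cW Esym Etr Eloc x y Wx Wy.
have Exx z : W z -> E z z by move=> Wz; exact: (nbhs_singleton (Eloc _ Wz)).
pose B := W `&` [set z | E x z].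
suff BW : B = W by move: Wy; rewrite -BW => -[].
apply: cW; first by exists x; split => //; exact: Exx.
- exists [set z | W z -> E x z]°; first exact: open_interior.
  apply/seteqP; split=> [z [Wz Exz]|z [Wz /interior_subset zE]]; last first.
    by split=> //; exact: zE.
  split=> //; move: (Eloc _ Wz); rewrite /interior/=.
  by apply: filterS => w Ezw /Ezw; exact: Etr.
- exists (~` [set z | W z -> ~ E x z]°).
    exact/open_closedC/open_interior.
  apply/seteqP; split=> [z [Wz Exz]|z [Wz zE]].
    by split=> // /interior_subset /(_ Wz).
  split=> //; apply: contrapT => nExz; apply: zE; rewrite /interior/=.
  move: (Eloc _ Wz); apply: filterS => w Ezw /Ezw {}Ezw Exw.
  by apply: nExz; exact: Etr Exw (Esym _ _ Ezw).
Qed.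

(** Finite covers as an induction principle: a property of sets that passes to
    binary unions and holds near each point of a compact set holds for it. *)
Lemma compact_ind (T : ptopologicalType) (X : set T) (P : set T -> Prop) :
  compact X -> P set0 -> (forall A B, P A -> P B -> P (A `|` B)) ->
  (forall x, X x -> exists O, [/\ open O, O x & P (X `&` O)]) -> P X.
Proof.
rewrite compact_cover => cX P0 PU Ploc.
have /choice[f fP] : forall x, exists O : set T,
    X x -> [/\ open O, O x & P (X `&` O)].
  move=> x; have [/Ploc [N NP]|nXx] := pselect (X x); last by exists set0.
  by exists N.
have [i /fP[]//|x Xx|D' D'X XD'] := cX T X f.
  by exists x => //; have [] := fP _ Xx.
suff PD (s : seq T) : {in s, forall x, X x} ->
    P (X `&` \bigcup_(i in [set` s]) f i).
  have /(setIidl) <- := XD'; apply: (PD (enum_fset D')) => x xD.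
  exact/set_mem/D'X.
elim: s => [_|a s IH sX].
  rewrite (_ : [set` [::]] = set0) ?bigcup_set0 ?setI0 //.
  by apply/seteqP; split.
rewrite (_ : _ `&` _ = (X `&` f a) `|` (X `&` \bigcup_(i in [set` s]) f i)).
  apply: PU; last by apply: IH => x xs; apply: sX; rewrite inE xs orbT.
  by have [|] := fP a => //; apply: sX; rewrite inE eqxx.
apply/seteqP; split=> [x [Xx [i /=]]|x].
  rewrite inE => /orP[/eqP->|si] fx; first by left.
  by right; split => //; exists i.
move=> [[Xx fx]|[Xx [i /= si fx]]]; split=> //.
  by exists a; rewrite //= inE eqxx.
by exists i; rewrite //= inE si orbT.
Qed.

(** * Components of a compact set are quasi-components *)

Section quasicomponent.
Context {R : realType} {V : normedModType R}.
Implicit Types X Z W : set V.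

Definition clopen_in X Z := [/\ Z `<=` X, closed Z & closed (X `\` Z)].

Lemma clopen_inT X : compact X -> clopen_in X X.
Proof.
move=> cX; split=> //; first exact: compact_closed (@norm_hausdorff _ V) cX.
by rewrite setDv; exact: closed0.
Qed.

Lemma clopen_inI X Z Z' : clopen_in X Z -> clopen_in X Z' ->
  clopen_in X (Z `&` Z').
Proof.
move=> [ZX cZ cXZ] [Z'X cZ' cXZ']; split; first by move=> x [/ZX].
  exact: closedI.
by rewrite setDIr; exact: closedU.
Qed.

Lemma clopen_in_avoid X x W : compact X -> closed W ->
  (forall y, X y -> W y -> exists Z, [/\ clopen_in X Z, Z x & ~ Z y]) ->
  X x -> exists Z, [/\ clopen_in X Z, Z x & Z `&` W = set0].
Proof.
move=> cX cW sep Xx.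
pose P (A : set V) := exists Z, [/\ clopen_in X Z, Z x & Z `&` A = set0].
suff [Z [cZ Zx ZXW]] : P (X `&` W).
  exists Z; split=> //; rewrite -ZXW setIA; congr (_ `&` _).
  by apply/esym/setIidPl; case: cZ.
apply: compact_ind.
- exact: compact_closedI.
- by exists X; rewrite setI0; split=> //; exact: clopen_inT.
- move=> A B [Z [cZ Zx ZA]] [Z' [cZ' Z'x Z'B]]; exists (Z `&` Z').
  split=> //; first exact: clopen_inI.
  rewrite -subset0 => y [[Zy Z'y] [Ay|By]].
    by rewrite -ZA.
  by rewrite -Z'B.
- move=> y [Xy Wy]; have [Z [cZ Zx nZy]] := sep y Xy Wy.
  exists (~` Z); split=> //; first by apply: closed_openC; case: cZ.
  by exists Z; split=> //; rewrite setICA setICr setI0.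
Qed.

(** The set [Q] of the points that no clopen set separates from [x] is
    connected: a splitting of [Q] into closed pieces extends to disjoint open
    sets [G] and [H], some clopen [Z] containing [x] lies in [G `|` H] by
    compactness, and [Z `&` G] is then clopen, so it contains all of [Q]. Hence
    [Q] is contained in the component of [x], and compactness of [W `&` X]
    concludes. *)
Lemma component_clopen X x W : compact X -> X x -> closed W ->
  connected_component X x `&` W = set0 ->
  exists Z, [/\ clopen_in X Z, Z x & Z `&` W = set0].
Proof.
move=> cX Xx cW CW.
pose Q := [set y | X y /\ forall Z, clopen_in X Z -> Z x -> Z y].
have clX : closed X := compact_closed (@norm_hausdorff _ V) cX.
have cQ : closed Q.
  rewrite (_ : Q = X `&` \bigcap_(Z in [set Z | clopen_in X Z /\ Z x]) Z).
    by apply: closedI => //; apply: closed_bigI => Z [[]].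
  apply/seteqP; split=> y [Xy yZ]; split=> //.
    by move=> Z [cZ Zx]; exact: yZ.
  by move=> Z cZ Zx; exact: yZ.
have Qx : Q x by [].
have Qconn : connected Q.
  move=> B [b Bb] [C oC BC] [D cD BD].
  (* Of the two pieces of the splitting, take the one that contains x. *)
  wlog Bx : B C D b Bb oC BC cD BD / B x.
    move=> WL; have [Bx|nBx] := pselect (B x); first exact: (WL B C D b).
    have QB : Q `\` B = Q.
      apply: (WL (Q `\` B) (~` D) (~` C) x) => //.
      - exact: closed_openC.
      - apply/seteqP; split=> y [Qy]; rewrite BD => nB; split=> //.
          by move=> ?; apply: nB.
        by case=> _ /nB.
      - exact: open_closedC.
      - apply/seteqP; split=> y [Qy]; rewrite BC => nB; split=> //.
          by move=> ?; apply: nB.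
        by case=> _ /nB.
    have Qb : Q b by move: (Bb); rewrite BC => -[].
    by move: Qb; rewrite -QB => -[_ /(_ Bb)].
  pose F := Q `\` C.
  have [|||G [H [oG oH BG FH GH]]] :=
      (@normal_openP R V).1 (@pseudometric_normal R V) B F.
  - by rewrite BD; exact: closedI.
  - by rewrite /F setDE; apply: closedI => //; exact: open_closedC.
  - by rewrite -subset0 => y []; rewrite BC => -[_ Cy] [_ /(_ Cy)].
  have [|y Xy nGHy||Z [cZ Zx ZGH]] := @clopen_in_avoid X x (~` (G `|` H)) cX.
  - by apply: open_closedC; exact: openU.
  - apply: contrapT => nsep; apply: nGHy.
    have [Cy|nCy] := pselect (C y); [left; apply: BG|right; apply: FH].
      rewrite BC; split=> //; split=> // Z cZ Zx.
      by apply: contrapT => nZy; apply: nsep; exists Z.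
    split=> //; split=> // Z cZ Zx.
    by apply: contrapT => nZy; apply: nsep; exists Z.
  - by [].
  have ZGH' y : Z y -> G y \/ H y.
    by move=> Zy; apply: contrapT => nGH; have : set0 y by rewrite -ZGH.
  have [ZX clZ clXZ] := cZ.
  have cZG : clopen_in X (Z `&` G).
    split; first by move=> y [/ZX].
    - rewrite (_ : _ `&` _ = Z `&` ~` H).
        by apply: closedI => //; exact: open_closedC.
      apply/seteqP; split=> y [Zy].
        by move=> Gy; split=> // Hy; rewrite -[False]/(set0 y) -GH.
      by case: (ZGH' y Zy).
    - rewrite setDIr; rewrite (_ : _ `|` _ = (X `\` Z) `|` (Z `&` ~` G)).
        by apply: closedU => //; apply: closedI => //; exact: open_closedC.
      apply/seteqP; split=> y [[Xy nZy]|[Zy nGy]].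
      - by left.
      - by have [|] := pselect (Z y); [right|left].
      - by left.
      - by right; split=> //; exact: ZX.
  apply/seteqP; split; first by rewrite BC => y [].
  move=> y Qy; have [_ Gy] : (Z `&` G) y.
    by apply: Qy.2 => //; split=> //; exact: BG.
  rewrite BC; split=> //; apply: contrapT => nCy.
  have : set0 y by rewrite -GH; split=> //; exact: FH.
  by [].
apply: clopen_in_avoid => // y Xy Wy; apply: contrapT => nsep.
have Qy : Q y.
  split=> // Z cZ Zx; apply: contrapT => nZy; apply: nsep; by exists Z.
suff : set0 y by [].
rewrite -CW; split=> //; apply: connected_component_max Qy => //.
by move=> z [].
Qed.

End quasicomponent.

(** * Segments, and continua in the complement of a closed set *)

Section segment.
Context {R : realType} {V : normedModType R}.
Implicit Types (A S W : set V) (x y z : V).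

Definition segment x y : set V := [set x + t *: (y - x) | t in `[0, 1]%classic].

Definition segment_convex S := forall x y, S x -> S y -> segment x y `<=` S.

Lemma segment_left x y : segment x y x.
Proof.
by exists 0; rewrite ?scale0r ?addr0//= in_itv/= lexx ler01.
Qed.

Lemma segment_right x y : segment x y y.
Proof.
by exists 1; rewrite ?scale1r ?subrKC//= in_itv/= lexx ler01.
Qed.

Lemma continuous_segment x y : continuous (fun t : R => x + t *: (y - x)).
Proof.
by move=> t; apply: cvgD; [exact: cvg_cst|exact: scalel_continuous].
Qed.

Lemma segment_is_connected x y : connected (segment x y).
Proof.
apply: connected_continuous_connected; first exact: segment_connected.
by apply: continuous_subspaceT; exact: continuous_segment.
Qed.

Lemma segment_is_compact x y : compact (segment x y).
Proof.
apply: continuous_compact; last exact: segment_compact.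
by apply: continuous_subspaceT; exact: continuous_segment.
Qed.

Lemma segment_distl x y z : segment x y z -> `|x - z| <= `|x - y|.
Proof.
move=> [t /=]; rewrite in_itv/= => /andP[t0 t1] <-.
rewrite opprD addNKr normrN normrZ ger0_norm// distrC.
by rewrite ler_piMl.
Qed.

Lemma segment_sym x y : segment x y = segment y x.
Proof.
wlog suff : x y / segment x y `<=` segment y x.
  by move=> H; apply/seteqP; split; apply: H.
move=> z [t /=]; rewrite in_itv/= => /andP[t0 t1] <-; exists (1 - t).
  by rewrite /= in_itv/= subr_ge0 t1 gerBl t0.
rewrite scalerBl scale1r -(opprB y x) !scalerN opprK.
by rewrite addrA opprB addrCA subrr addr0.
Qed.

Lemma segment_distr x y z : segment x y z -> `|y - z| <= `|x - y|.
Proof. by rewrite segment_sym (distrC x); exact: segment_distl. Qed.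

Lemma near_segment A x : closed A -> ~ A x ->
  \forall y \near x, segment x y `<=` ~` A.
Proof.
move=> cA nAx; have /nbhs_ballP[e /= e0 eA] : nbhs x (~` A).
  by apply: open_nbhs_nbhs; split => //; exact: closed_openC.
apply/nbhs_ballP; exists e => //= y.
rewrite -ball_normE /= => xy z /segment_distl xz.
by apply: eA; rewrite -ball_normE /=; exact: le_lt_trans xy.
Qed.

Lemma connected_component_segment A x y :
  segment x y `<=` A -> connected_component A x y.
Proof.
move=> xyA; exists (segment x y); last exact: segment_right.
split=> //; [exact: segment_left | exact: segment_is_connected].
Qed.

(** The points that can be reached from [p] by a continuum in [S `\` A] form a
    set that is open and closed in [S `\` A], because short segments avoid the
    closed set [A]. *)
Lemma compact_connection S A p q : segment_convex S -> closed A ->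
  connected_component (S `\` A) p q ->
  exists W, [/\ compact W, connected W, W `<=` S `\` A, W p & W q].
Proof.
move=> cS cA [W0 [W0p W0SA cW0] W0q].
pose E x y := exists W, [/\ compact W, connected W, W `<=` S `\` A, W x & W y].
apply: (connected_chain (E := E) cW0) => //.
- by move=> x y [W [*]]; exists W.
- move=> x y z [W [W1 W2 W3 W4 W5]] [W' [W1' W2' W3' W4' W5']].
  exists (W `|` W'); split; [exact: compactU | | | by left | by right].
    by apply: connectedU => //; exists y.
  by rewrite subUset.
- move=> x W0x; have [Sx nAx] := W0SA x W0x.
  near=> y => W0y; exists (segment x y); split.
  + exact: segment_is_compact.
  + exact: segment_is_connected.
  + move=> z xyz; split; first by apply: cS xyz => //; have [] := W0SA y W0y.
    by move: z xyz; near: y; exact: near_segment.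
  + exact: segment_left.
  + exact: segment_right.
Unshelve. all: by end_near.
Qed.

Lemma compact_dist A W : compact A -> closed W -> A `&` W = set0 ->
  exists2 e : R, 0 < e & forall x y, A x -> W y -> e <= `|x - y|.
Proof.
move=> cA cW AW.
pose P (B : set V) :=
  exists2 e : R, 0 < e & forall x y, B x -> W y -> e <= `|x - y|.
apply: (compact_ind (P := P) cA).
- by exists 1.
- move=> B B' [e e0 eP] [e' e'0 e'P]; exists (Num.min e e').
    by rewrite lt_min e0.
  move=> x y [Bx|B'x] Wy; rewrite ge_min; first by rewrite eP.
  by rewrite (e'P x)// orbT.
- move=> x Ax; have nWx : ~ W x.
    by move=> Wx; rewrite -[False]/((set0 : set V) x) -AW.
  have /nbhs_ballP[e /= e0 eW] : nbhs x (~` W).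
    by apply: open_nbhs_nbhs; split => //; exact: closed_openC.
  have e20 : 0 < e / 2 by rewrite divr_gt0.
  exists (ball x (e / 2)); split; [exact: ball_open|exact: ballxx|].
  exists (e / 2) => // z y [_]; rewrite -ball_normE /= => xz Wy.
  rewrite leNgt; apply/negP => zy; apply: (eW y) => //.
  rewrite -ball_normE /= [e]splitr -(subrKA z).
  by apply: le_lt_trans (ler_normD _ _) _; exact: ltrD.
Qed.

End segment.

(** * Unicoherence of convex sets *)

Section unicoherence.
Context {R : realType} {V : normedModType R}.
Implicit Types (x y z w : V).

Lemma segment_dist_lt (e : R) x y z w :
  `|w - x| < e -> `|w - y| < e -> segment x y z -> `|w - z| < e.
Proof.
move=> wx wy [t /=]; rewrite in_itv/= => /andP[t0 t1] <-.
have -> : w - (x + t *: (y - x)) = (1 - t) *: (w - x) + t *: (w - y).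
  rewrite scalerBl scale1r -addrA -scalerN -scalerDr opprB subrKA.
  by rewrite opprD addrA -scalerN opprB.
apply: le_lt_trans (ler_normD _ _) _; rewrite !normrZ ger0_norm ?subr_ge0//.
rewrite (ger0_norm t0).
have [->|tn0] := eqVneq t 0; first by rewrite subr0 mul1r mul0r addr0.
have -> : e = (1 - t) * e + t * e by ring.
apply: ler_ltD; first by rewrite ler_wpM2l ?subr_ge0// ltW.
by rewrite ltr_pM2l// lt0r tn0.
Qed.

(** Let [A] and [B] be at distance at least [2 * e]. The complements of [A] and
    of [B] cover [S]; glue two copies of the trivial covering with fibre Z over
    them by the shift [c], the indicator of the component of [p] in the
    complement of [A `|` B]. A convex set is simply connected, so this covering
    has a global section [Phi], built by adding up the shifts [J] along the
    segment from [p]. Then [Phi + d] is a locally constant function off [A],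
    [Phi + d - c] is one off [B], and a point [q] joined to [p] off both must
    satisfy [c q = c p]. *)
Section torsor.
Variables (S A B : set V) (p : V) (e M : R).
Hypothesis cS : segment_convex S.
Hypothesis bS : forall x y, S x -> S y -> `|x - y| <= M.
Hypotheses (clA : closed A) (clB : closed B) (e0 : 0 < e).
Hypothesis sepAB : forall a b, A a -> B b -> 2 * e <= `|a - b|.
Hypothesis Sp : S p.

(* The chart used at x: off A if far_A x, and off B otherwise. *)
Let far_A x : bool := `[< forall a, A a -> e <= `|x - a| >].

Let far_AP x y : far_A x -> `|x - y| < e -> ~ A y.
Proof. by move=> /asboolP H xy /H; rewrite leNgt xy. Qed.

Let far_BP x y : ~~ far_A x -> `|x - y| < e -> ~ B y.
Proof.
move=> /asboolPn/existsNP[a /not_implyP[Aa /negP]]; rewrite -ltNge => xa xy By.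
have := sepAB Aa By; rewrite -(subrKA x) leNgt => /negP; apply.
apply: le_lt_trans (ler_normD _ _) _; rewrite (distrC a) mulr_natl mulr2n.
exact: ltrD.
Qed.

Let c x : int := (`[< connected_component (S `\` (A `|` B)) p x >])%:Z.

Let c_segment x y : S x -> S y -> segment x y `<=` ~` A ->
  segment x y `<=` ~` B -> c x = c y.
Proof.
move=> Sx Sy xyA xyB; rewrite /c.
have xy : connected_component (S `\` (A `|` B)) x y.
  apply: connected_component_segment => z xyz; split; first exact: cS xyz.
  by case; [exact: xyA|exact: xyB].
congr (Posz (nat_of_bool _)); apply: asbool_equiv_eq; split=> h.
  exact: connected_component_trans h xy.
by apply: connected_component_trans h (connected_component_sym xy).
Qed.

(* The coordinate, in the chart off A, of the origin of the chart used at x. *)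
Let d x : int := if far_A x then 0 else c x.

Let J x y : int := if far_A x == far_A y then 0 else d x - d y.

Let J_refl x : J x x = 0. Proof. by rewrite /J eqxx. Qed.

Let c_near x y w : S x -> S y -> ~~ far_A x -> far_A w ->
  `|x - y| < e -> `|w - x| < e -> `|w - y| < e -> c x = c y.
Proof.
move=> Sx Sy xA wA xy wx wy; apply: c_segment => // z xyz.
  exact/(far_AP wA)/(segment_dist_lt _ _ xyz).
by apply: (far_BP xA); apply: le_lt_trans xy; exact: segment_distl.
Qed.

(* Three close points use at most two charts; when the two points of one chart
   are compared with the third, the segment between them avoids A and B. *)
Let J_cocycle x y w : S x -> S y -> S w ->
  `|x - y| < e -> `|y - w| < e -> `|x - w| < e -> J x y + J y w = J x w.
Proof.
move=> Sx Sy Sw xy yw xw; rewrite /J /d.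
case: (boolP (far_A x)) => Ax; case: (boolP (far_A y)) => Ay;
  case: (boolP (far_A w)) => Aw //=; rewrite ?subrr ?addr0 ?add0r//.
- by rewrite addNr.
- by rewrite (@c_near y w x).
- by rewrite (@c_near x w y) ?subrr// distrC.
- by rewrite (@c_near x y w)// distrC.
Qed.

Variable n : nat.
Hypothesis n0 : (0 < n)%N.
Hypothesis nM : M / n%:R < e / 2.

Let pt x (k : nat) : V := p + (k%:R / n%:R) *: (x - p).

Let nR0 : 0 < n%:R :> R. Proof. by rewrite ltr0n. Qed.

Let pt_S x k : S x -> (k <= n)%N -> S (pt x k).
Proof.
move=> Sx kn; apply: (cS Sp Sx); exists (k%:R / n%:R) => //=.
by rewrite in_itv/= divr_ge0 ?ler0n//= ler_pdivrMr// mul1r ler_nat.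
Qed.

Let pt_step x k : S x -> `|pt x k - pt x k.+1| < e / 2.
Proof.
move=> Sx; apply: le_lt_trans nM.
rewrite /pt [p + _]addrC addrKA -scalerBl -mulrBl normrZ normrM normfV.
rewrite -natr1 opprD addrA subrr sub0r normrN1 mul1r (ger0_norm (ltW nR0)).
by rewrite mulrC ler_pM2r ?invr_gt0//; exact: bS.
Qed.

Let pt_dist x y k : (k <= n)%N -> `|pt x k - pt y k| <= `|x - y|.
Proof.
move=> kn; rewrite /pt [p + _]addrC addrKA -scalerBr normrZ opprB subrKA.
rewrite ger0_norm ?divr_ge0 ?ler0n// ler_piMl//.
by rewrite ler_pdivrMr// mul1r ler_nat.
Qed.

Let Phi x : int := \sum_(k < n) J (pt x k) (pt x k.+1).

(* The shifts cancel around each of the thin quadrilaterals between the chains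
   that lead from p to x and from p to y. *)
Let Phi_step x y : S x -> S y -> `|x - y| < e / 2 -> Phi y - Phi x = J x y.
Proof.
move=> Sx Sy xy.
have ptn z : pt z n = z by rewrite /pt divff ?lt0r_neq0// scale1r subrKC.
suff key m : (m <= n)%N -> \sum_(k < m) J (pt x k) (pt x k.+1) +
    J (pt x m) (pt y m) = \sum_(k < m) J (pt y k) (pt y k.+1).
  by have := key n (leqnn n); rewrite !ptn /Phi => <-; rewrite addrC addKr.
elim: m => [_|m IH mn].
  by rewrite !big_ord0 /pt mul0r !scale0r J_refl addr0.
have mn' : (m <= n)%N by exact: ltnW.
rewrite !big_ord_recr /= -IH// -!addrA; congr (_ + _).
have e2e : e / 2 < e by rewrite ltr_pdivrMr// ltr_pMr// ltr1n.
have h1 := pt_step m Sx; have h2 := pt_step m Sy.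
have h3 := le_lt_trans (pt_dist x y mn') xy.
have h4 := le_lt_trans (pt_dist x y mn) xy.
have h5 : `|pt x m - pt y m.+1| < e.
  rewrite -(subrKA (pt x m.+1)) [e]splitr.
  by apply: le_lt_trans (ler_normD _ _) _; exact: ltrD.
have h6 := lt_trans h1 e2e; have h7 := lt_trans h2 e2e.
have h8 := lt_trans h3 e2e; have h9 := lt_trans h4 e2e.
rewrite J_cocycle// ?J_cocycle//; exact: pt_S.
Qed.

Let e2e : e / 2 < e. Proof. by rewrite ltr_pdivrMr// ltr_pMr// ltr1n. Qed.

Let near_close x : \forall y \near x, `|x - y| < e / 2.
Proof.
by apply: (@cvgr_dist_lt _ _ _ _ _ id) => //; rewrite divr_gt0.
Qed.

Let primitive_A q : connected_component (S `\` A) p q ->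
  Phi p + d p = Phi q + d q.
Proof.
move=> [W [Wp WSA cW] Wq].
apply: (connected_chain (E := fun x y => Phi x + d x = Phi y + d y) cW) => //.
  by move=> x y z -> ->.
move=> x Wx; have [Sx nAx] := WSA x Wx; near=> y => Wy.
have [Sy nAy] := WSA y Wy.
have xy : `|x - y| < e / 2 by near: y; exact: near_close.
have xy' := lt_trans xy e2e.
have /eqP := Phi_step Sx Sy xy; rewrite subr_eq => /eqP->.
rewrite /J [RHS]addrAC addrC; congr (_ + _).
case: ifPn => [/eqP tau|_]; last by rewrite subrK.
rewrite add0r /d tau; case: ifPn => // fy; apply: c_segment => //.
  by near: y; exact: near_segment.
rewrite -tau in fy => z xyz; apply: (far_BP fy).
exact: le_lt_trans (segment_distl xyz) _.
Unshelve. all: by end_near.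
Qed.

Let primitive_B q : connected_component (S `\` B) p q ->
  Phi p + d p - c p = Phi q + d q - c q.
Proof.
move=> [W [Wp WSA cW] Wq].
apply: (connected_chain
  (E := fun x y => Phi x + d x - c x = Phi y + d y - c y) cW) => //.
  by move=> x y z -> ->.
move=> x Wx; have [Sx nBx] := WSA x Wx; near=> y => Wy.
have [Sy nBy] := WSA y Wy.
have xy : `|x - y| < e / 2 by near: y; exact: near_close.
have xy' := lt_trans xy e2e.
have /eqP := Phi_step Sx Sy xy; rewrite subr_eq => /eqP->.
have xyB : segment x y `<=` ~` B by near: y; exact: near_segment.
have [fx|fx] := boolP (far_A x).
  have -> : c x = c y.
    apply: c_segment => // z xyz.
    by apply: (far_AP fx); exact: le_lt_trans (segment_distl xyz) _.
  by rewrite /J /d fx; case: ifPn => [/eqP<-|_]; ring.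
rewrite /J /d (negbTE fx); have [fy|fy] /= := boolP (far_A y).
  have -> : c x = c y.
    apply: c_segment => // z xyz.
    by apply: (far_AP fy); exact: le_lt_trans (segment_distr xyz) _.
  by ring.
by ring.
Unshelve. all: by end_near.
Qed.

Lemma torsor_trivial q : ~ A p -> ~ B p ->
  connected_component (S `\` A) p q -> connected_component (S `\` B) p q ->
  connected_component (S `\` (A `|` B)) p q.
Proof.
move=> nAp nBp /primitive_A hA /primitive_B; rewrite hA => /addrI/oppr_inj.
rewrite /c asboolT; last by apply: connected_component_refl; split=> // -[].
by case: asboolP.
Qed.

End torsor.

(** Janiszewski's theorem for disjoint compact sets. The argument does not
    depend on the dimension: [S] may be any bounded convex set. *)
Lemma janiszewski (S A B : set V) p q : segment_convex S -> bounded_set S ->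
  compact A -> compact B -> A `&` B = set0 -> 
  connected_component (S `\` A) p q -> connected_component (S `\` B) p q ->
  connected_component (S `\` (A `|` B)) p q.
Proof.
move=> cS bS cA cB AB pqA pqB.
have clA := compact_closed (@norm_hausdorff _ V) cA.
have clB := compact_closed (@norm_hausdorff _ V) cB.
have [e e0 sep] := compact_dist cA clB AB.
have [Sp nAp] : (S `\` A) p by case: pqA => W [? + ? _]; exact.
have [_ nBp] : (S `\` B) p by case: pqB => W [? + ? _]; exact.
have [M [Mreal bM]] := bS.
pose M' := `|M| + 1.
have M'0 : 0 < M' by rewrite ltr_wpDl.
have SM' x : S x -> `|x| <= M'.
  by apply: bM; rewrite (le_lt_trans (ler_norm M))// ltrDl.
have e4 : 0 < e / 2 / 2 by rewrite !divr_gt0.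
pose m := 2 * M' / (e / 2 / 2); pose n := Num.bound m.
have m0 : 0 < m by rewrite divr_gt0// mulr_gt0.
have mn : m < n%:R by apply: archi_boundP; exact: ltW.
have n0 : (0 < n)%N by rewrite -(ltr0n R); exact: lt_trans mn.
apply: (@torsor_trivial S A B p (e / 2) (2 * M') _ _ clA clB _ _ Sp n) => //.
- move=> x y Sx Sy; apply: le_trans (ler_normB _ _) _.
  by rewrite mulr_natl mulr2n lerD// SM'.
- by rewrite divr_gt0.
- by move=> a b Aa Bb; rewrite mulrC divfK ?pnatr_eq0//; exact: sep.
- by rewrite ltr_pdivrMr ?ltr0n// -ltr_pdivrMl// mulrC.
Qed.

End unicoherence.

(** * Separation by a compact set happens at one of its components *)

Lemma connected_component_mono (T : topologicalType) (A B : set T) (x : T) :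
  A `<=` B -> connected_component A x `<=` connected_component B x.
Proof.
move=> AB y [W [Wx WA cW] Wy]; exists W => //; split=> //.
exact: subset_trans AB.
Qed.

Section separation.
Context {R : realType} {V : normedModType R}.

(** The sets contained in a clopen subset of [X] off which [p] and [q] are
    joined are closed under unions, by [janiszewski]. They include a
    neighbourhood of each point of [X]: the continuum joining [p] to [q] off the
    component of the point also misses some clopen set around that component. *)
Lemma connected_off_components (S X : set V) (p q : V) :
  segment_convex S -> bounded_set S -> compact X -> S p -> S q ->
  (forall x, X x -> connected_component (S `\` connected_component X x) p q) ->
  connected_component (S `\` X) p q.
Proof.
move=> cS bS cX Sp Sq Hpq.
have clX : closed X := compact_closed (@norm_hausdorff _ V) cX.
pose P (A : set V) := exists Z, [/\ clopen_in X Z, A `<=` Z &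
  connected_component (S `\` Z) p q].
suff [Z [[ZX _ _] XZ]] : P X by have -> : Z = X by apply/seteqP.
apply: (compact_ind cX).
- exists set0; split=> //.
    by split=> //; [exact: closed0|rewrite setD0].
  by apply: connected_component_segment; rewrite setD0; exact: cS.
- move=> A B [Z [[ZX clZ clXZ] AZ Zpq]] [Z' [[Z'X clZ' clXZ'] BZ' Z'pq]].
  exists (Z `|` Z'); split.
  + split; [by rewrite subUset | exact: closedU |].
    by rewrite setDUr; exact: closedI.
  + by move=> x [/AZ|/BZ']; [left|right].
  + have sub_compact (Y : set V) : closed Y -> Y `<=` X -> compact Y.
      by move=> clY YX; exact: subclosed_compact cX YX.
    have -> : Z `|` Z' = Z `|` (Z' `&` (X `\` Z)).
      apply/seteqP; split=> x [Zx|]; [by left| |by left|by move=> []; right].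
      move=> Z'x; have [|nZx] := pselect (Z x); [by left|right].
      by split=> //; split=> //; exact: Z'X.
    apply: janiszewski => //.
    * exact: sub_compact.
    * by apply: sub_compact; [exact: closedI|move=> x [/Z'X]].
    * by rewrite -subset0 => x [Zx [_ [_ /(_ Zx)]]].
    * by apply: connected_component_mono Z'pq; apply: setDS => x [].
- move=> x Xx; pose C := connected_component X x.
  have [W [cW conW WSC Wp Wq]] :=
    compact_connection cS (@component_closed _ X x clX) (Hpq x Xx).
  have [||Z [cZ Zx ZW]] := @component_clopen R V X x W cX Xx.
  + exact: compact_closed (@norm_hausdorff _ V) cW.
  + by rewrite -subset0 => y [Cy /WSC[_ /(_ Cy)]].
  exists (~` (X `\` Z)); split.
  + by apply: closed_openC; case: cZ.
  + by case.
  exists Z; split=> //.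
    by move=> y [Xy nXZy]; apply: contrapT => nZy; apply: nXZy.
  exists W => //; split=> // y Wy; split; first by have [] := WSC y Wy.
  by move=> Zy; rewrite -[False]/((set0 : set V) y) -ZW.
Qed.

End separation.

(** * Two crossing continua of a rectangle meet *)

Lemma norm_pair_lt (R : realType) (z : R * R) (e : R) :
  (`|z| < e) = (`|z.1| < e) && (`|z.2| < e).
Proof. by rewrite prod_normE gt_max. Qed.

Lemma norm_pair_ge (R : realType) (z : R * R) (e : R) :
  (e <= `|z|) = (e <= `|z.1|) || (e <= `|z.2|).
Proof. by rewrite prod_normE le_max. Qed.

Section crossing.
Context {R : realType}.
Local Notation V := (R * R)%type.
Implicit Types (a b v : V) (s : seq V).

Lemma connected_path (W : set V) (e : R) p q : 0 < e -> connected W ->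
  W p -> W q -> exists s, [/\ path (fun x y => `|x - y| < e) p s,
    last p s = q & {in s, forall x, W x}].
Proof.
move=> e0 cW Wp Wq.
pose reach x := exists s, [/\ path (fun x y => `|x - y| < e) p s,
  last p s = x & {in s, forall x, W x}].
suff /(_ p q Wp Wq) [+ _] : forall x y, W x -> W y -> (reach x <-> reach y).
  by apply; exists [::].
apply: (connected_chain cW) => [x y|x y z|x Wx].
- by case.
- by move=> [xy yx] [yz zy]; split=> [/xy/yz|/zy/yx].
- near=> y => Wy.
  have step u v : W v -> `|u - v| < e -> reach u -> reach v.
    move=> Wv uv [s [ps ls sW]]; exists (rcons s v); split.
    + by rewrite rcons_path ps ls.
    + by rewrite last_rcons.
    + by move=> z; rewrite mem_rcons inE => /predU1P[->//|/sW].
  have xy : `|x - y| < e by near: y; exact: (@cvgr_dist_lt _ _ _ _ _ id).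
  by split; apply: step => //; rewrite distrC.
Unshelve. all: by end_near.
Qed.

(** For a small step from [v] to [v'] that stays away from the origin, the
    signed number of crossings of the half-line [x > 0], [y = 0]. *)
Definition ray_crossing v v' : int :=
  if 0 < v.1 then (0 <= v'.2)%R%:Z - (0 <= v.2)%R%:Z else 0.

(** The winding number of a small quadrilateral far from the origin is zero: its
    four vertices have either first coordinates of one sign or second
    coordinates of one sign. *)
Lemma ray_crossing_cell (e : R) v1 v2 v3 v4 : 3 * e <= `|v1| ->
  `|v1 - v2| < e -> `|v1 - v3| < e -> `|v1 - v4| < 2 * e ->
  ray_crossing v1 v2 + ray_crossing v2 v4 =
  ray_crossing v1 v3 + ray_crossing v3 v4.
Proof.
rewrite !norm_pair_lt norm_pair_ge /= => v1e /andP[x12 y12] /andP[x13 y13]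
  /andP[x14 y14].
move: x12 y12 x13 y13 x14 y14; rewrite !ltr_norml.
move=> /andP[? ?] /andP[? ?] /andP[? ?] /andP[? ?] /andP[? ?] /andP[? ?].
rewrite /ray_crossing; case/orP: v1e => v1e.
  have far (x : R) : `|v1.1 - x| < 3 * e -> (0 < x) = (0 < v1.1).
    rewrite ltr_norml => /andP[? ?]; move: v1e; rewrite ler_normr => /orP[?|?].
      by rewrite [LHS]lt_def; apply/idP/idP => ?; lra.
    by apply/idP/idP => ?; lra.
  rewrite !far; last 2 first.
  - by rewrite ltr_norml; apply/andP; split; lra.
  - by rewrite ltr_norml; apply/andP; split; lra.
  by case: ifP => // _; ring.
have far (x : R) : `|v1.2 - x| < 3 * e -> (0 <= x) = (0 <= v1.2).
  rewrite ltr_norml => /andP[? ?]; move: v1e; rewrite ler_normr => /orP[?|?].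
    by apply/idP/idP => ?; lra.
  by apply/idP/idP => ?; lra.
rewrite !far ?subrr; first by rewrite !if_same.
all: by rewrite ltr_norml; apply/andP; split; lra.
Qed.

(** The signed number of times the chain [b :: s], seen from [a], crosses the
    horizontal half-line to the left of [a]. *)
Fixpoint crossing_number a b s : int :=
  if s is b' :: s' then
    ray_crossing (a - b) (a - b') + crossing_number a b' s'
  else 0.

(** Moving [a] slightly only changes the crossing number through the two ends of
    the chain. *)
Lemma crossing_number_move (e : R) a a' b s : `|a - a'| < e ->
  path (fun x y => `|x - y| < e) b s ->
  {in b :: s, forall x, 3 * e <= `|a - x|} ->
  ray_crossing (a - b) (a' - b) + crossing_number a' b s =
  crossing_number a b s + ray_crossing (a - last b s) (a' - last b s).
Proof.
move=> aa'; elim: s b => [b _ _|b' s IH b /= /andP[bb' ps] far] /=.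
  by rewrite addrC.
rewrite -addrA -IH//; last by move=> x xs; apply: far; rewrite inE xs orbT.
rewrite !addrA; congr (_ + _); apply: (@ray_crossing_cell e).
- by apply: far; rewrite inE eqxx.
- by rewrite opprB subrKA.
- by rewrite opprB addrC subrKA distrC.
- have -> : a - b - (a' - b') = (a - a') + (b' - b).
    by rewrite opprB addrACA [RHS]addrACA (addrC (- b)).
  apply: le_lt_trans (ler_normD _ _) _; rewrite (distrC b') mulr_natl mulr2n.
  exact: ltrD.
Qed.

(** Replace [G] by a chain of small steps from the top to the bottom, started
    slightly above the top. Seen from a point of [D], the start of the chain
    stays above and its end stays below or level, so the crossing number is
    constant on [D]. It vanishes at the left edge, where no part of the chain
    lies to the left, and equals one at the right edge, to the left of which
    every crossing takes place. *)
Lemma separating_crossing (M : R) (G D : set V) t b l r :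
  compact G -> closed D -> connected G -> connected D -> G `&` D = set0 ->
  (forall z, G z -> `|z.1| <= M) ->
  (forall z, D z -> 0 <= z.2 <= 1) ->
  G t -> t.2 = 1 -> G b -> b.2 = 0 ->
  D l -> l.1 = - M -> D r -> r.1 = M -> False.
Proof.
move=> cG cD conG conD GD GM D01 Gt t1 Gb b0 Dl lM Dr rM.
have [e3 e30 far] := compact_dist cG cD GD.
pose e := e3 / 3; have e0 : 0 < e by rewrite divr_gt0.
have e3E : e3 = 3 * e by rewrite mulrC divfK ?pnatr_eq0.
have [s [ps ls sG]] := connected_path e0 conG Gt Gb.
(* The lift makes the first height strict; it only increases distances to D. *)
pose b' : V := (t.1, 1 + e / 2); pose s' := t :: s.
have ps' : path (fun x y => `|x - y| < e) b' s'.
  rewrite /= ps andbT norm_pair_lt/= subrr normr0 e0/= t1 addrAC subrr add0r.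
  by rewrite gtr0_norm; lra.
have sG' : {in s', forall x, G x}.
  by move=> x; rewrite inE => /predU1P[->//|/sG].
have ls' : last b' s' = b by [].
have farD a : D a -> {in b' :: s', forall x, 3 * e <= `|a - x|}.
  move=> Da x; rewrite inE -e3E => /predU1P[->|/sG' Gx]; last first.
    by rewrite distrC; exact: far.
  have := far t a Gt Da; rewrite distrC !norm_pair_ge/= t1 => /orP[->//|h].
  apply/orP; right; apply: le_trans h _.
  have /andP[_ a1] := D01 _ Da.
  by rewrite !ler0_norm; lra.
have cst : crossing_number l b' s' = crossing_number r b' s'.
  apply: (connected_chain
    (E := fun x y => crossing_number x b' s' = crossing_number y b' s') conD)
    => // [x y z -> -> //|x Dx].
  near=> y => Dy.
  have xy : `|x - y| < e by near: y; exact: (@cvgr_dist_lt _ _ _ _ _ id).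
  have := crossing_number_move xy ps' (farD x Dx).
  have /andP[x0 x1] := D01 _ Dx; have /andP[y0 y1] := D01 _ Dy.
  have top z : z <= 1 -> (0 <= z - (1 + e / 2)) = false.
    by move=> z1; apply/negbTE; rewrite -ltNge; lra.
  rewrite ls' /ray_crossing/= b0 !subr0 !top// x0 y0 subrr !if_same.
  by rewrite add0r addr0.
have left0 : crossing_number l b' s' = 0.
  have : {in b' :: s', forall x : V, l.1 <= x.1}.
    move=> x; rewrite lM inE => /predU1P[->|/sG' Gx].
      by have := GM _ Gt; rewrite ler_norml => /andP[].
    by have := GM _ Gx; rewrite ler_norml => /andP[].
  elim: (s') (b') => [//|x u IH] y /= yl.
  rewrite IH ?addr0; last by move=> z zu; apply: yl; rewrite inE zu orbT.
  rewrite /ray_crossing ifF//= subr_gt0; apply/negbTE; rewrite -leNgt.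
  by apply: yl; rewrite inE eqxx.
have right1 : crossing_number r b' s' =
    (0 <= r.2 - b.2)%R%:Z - (0 <= r.2 - b'.2)%R%:Z.
  rewrite -ls'; have : {in b' :: s', forall x : V, x.1 <= r.1}.
    move=> x; rewrite rM inE => /predU1P[->|/sG' Gx].
      by have := GM _ Gt; rewrite ler_norml => /andP[].
    by have := GM _ Gx; rewrite ler_norml => /andP[].
  move: ps' (farD r Dr).
  elim: (s') (b') => [|x u IH] y /=; first by rewrite subrr.
  move=> /andP[xy xu] rfar ry.
  rewrite IH//; last 2 first.
  - by move=> z zu; apply: rfar; rewrite inE zu orbT.
  - by move=> z zu; apply: ry; rewrite inE zu orbT.
  have ry1 : y.1 <= r.1 by apply: ry; rewrite inE eqxx.
  have : 3 * e <= `|r - y| by apply: rfar; rewrite inE eqxx.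
  rewrite /ray_crossing/= subr_gt0; case: ltP => [_ _|yr]; first by ring.
  have ryE : r.1 = y.1 by apply/eqP; rewrite eq_le yr.
  rewrite norm_pair_ge/= ryE subrr normr0 => /orP[|h].
    by rewrite leNgt mulr_gt0.
  suff -> : (0 <= r.2 - y.2) = (0 <= r.2 - x.2) by rewrite add0r.
  move: xy; rewrite norm_pair_lt/= => /andP[_]; rewrite ltr_norml => /andP[? ?].
  move: h; rewrite ler_normr => /orP[?|?]; apply/idP/idP => ?; lra.
move: cst; rewrite left0 right1 b0 subr0 /=.
have /andP[-> r1] := D01 _ Dr.
suff -> : (0 <= r.2 - (1 + e / 2)) = false by [].
by apply/negbTE; rewrite -ltNge; lra.
Unshelve. all: by end_near.
Qed.

End crossing.

(** * Joining a crossing continuum to a side of the box *)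

Lemma finite_subsets (T : Type) (F : set T) :
  finite_set F -> finite_set [set G : set T | G `<=` F].
Proof.
move=> /(@finite_seqP {classic T})[s ->].
pose f (m : (size s).-tuple bool) : set T := [set` mask m s].
apply: (@sub_finite_set _ _ (f @` setT)); last exact: finite_image.
move=> G /= Gs; pose m := map (fun x => `[< G x >]) s.
have sm : size m == size s by rewrite size_map.
exists (Tuple sm) => //; apply/seteqP; split=> x; rewrite /f /= /m -filter_mask.
  by rewrite mem_filter => /andP[/asboolP].
by move=> Gx; rewrite mem_filter Gs// andbT; apply/asboolP.
Qed.

(** The component of [a] off [G] reaches [G]: otherwise membership in it would
    be constant along the segment from [a] to [g]. Together with [G] it joins
    [a] to [g] off [C]. *)
Lemma connected_to_barrier (R : realType) (V : normedModType R)
    (S G C : set V) (a g : V) :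
  segment_convex S -> closed G -> closed C -> connected G -> G `<=` S `\` C ->
  S a -> G g -> connected_component (S `\` G) a `&` C = set0 ->
  connected_component (S `\` C) a g.
Proof.
move=> cS clG clC conG GSC Sa Gg VaC; apply: contrapT => nag.
have Gjoin x y : G x -> G y -> connected_component (S `\` C) x y.
  by move=> Gx Gy; exists G.
have nGa : ~ G a by move=> /Gjoin /(_ Gg).
pose Va := connected_component (S `\` G) a.
have VaSC x : Va x -> connected_component (S `\` C) a x.
  move=> Vax; exists Va => //; split.
  - exact: connected_component_refl.
  - move=> z Vaz; split; first by have [] := connected_component_sub Vaz.
    by move=> Cz; rewrite -[False]/((set0 : set V) z) -VaC.
  - exact: component_connected.
suff /(_ a g (segment_left _ _) (segment_right _ _))[+ _] :
    forall x y, segment a g x -> segment a g y -> (Va x <-> Va y).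
  case/(_ (connected_component_refl _)) => // W [_ WSG _] Wg.
  by have [_ /(_ Gg)] := WSG g Wg.
apply: (connected_chain (@segment_is_connected _ _ a g)) => [x y|x y z|x agx].
- by case.
- by move=> [xy yx] [yz zy]; split=> [/xy/yz|/zy/yx].
- have Sg : S g by have [] := GSC g Gg.
  have Sx : S x by exact: cS agx.
  have [Gx|nGx] := pselect (G x).
    have [_ nCx] := GSC x Gx.
    near=> y => agy; have Sy : S y by exact: cS agy.
    split=> [|Vay].
      by move=> /connected_component_sub[_ /(_ Gx)].
    case: nag; apply: (connected_component_trans _ (Gjoin _ _ Gx Gg)).
    apply: connected_component_trans (VaSC _ Vay) _.
    apply: connected_component_sym; apply: connected_component_segment.
    have xyC : segment x y `<=` ~` C by near: y; exact: near_segment.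
    by move=> z xyz; split; [exact: (cS x y)|exact: xyC].
  near=> y => agy; have Sy : S y by exact: cS agy.
  have xy : connected_component (S `\` G) x y.
    apply: connected_component_segment.
    have xyG : segment x y `<=` ~` G by near: y; exact: near_segment.
    by move=> z xyz; split; [exact: (cS x y)|exact: xyG].
  split=> h; first exact: connected_component_trans xy.
  by apply: connected_component_trans h (connected_component_sym xy).
Unshelve. all: by end_near.
Qed.

Definition crossing_components (T : topologicalType) (P Q A : set T) :=
  [set D | [/\ components A D, D `&` P !=set0 & D `&` Q !=set0]].

Section strip.
Context {R : realType}.
Local Notation V := (R * R)%type.

Definition strip : set V := [set z | 0 <= z.2 <= 1].
Definition level (t : R) : set V := [set z | z.2 = t].
Definition box (M : R) : set V := [set z | `|z.1| <= M /\ strip z].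

Lemma segment_pairP (x y z : V) : segment x y z -> exists t : R,
  [/\ 0 <= t <= 1, z.1 = x.1 + t * (y.1 - x.1) & z.2 = x.2 + t * (y.2 - x.2)].
Proof. by move=> [t /=]; rewrite in_itv/= => t01 <-; exists t. Qed.

Lemma segment_convex_strip : segment_convex strip.
Proof.
move=> x y /andP[x0 x1] /andP[y0 y1] z /segment_pairP[t [/andP[t0 t1] _ z2]].
by rewrite /strip /= z2; apply/andP; split; nra.
Qed.

Lemma segment_convex_box M : segment_convex (box M).
Proof.
move=> x y [xM Sx] [yM Sy] z xyz; split; last exact: segment_convex_strip xyz.
have [t [/andP[t0 t1] -> _]] := segment_pairP xyz.
move: xM yM; rewrite !ler_norml => /andP[? ?] /andP[? ?].
by apply/andP; split; nra.
Qed.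

Lemma bounded_box M : bounded_set (box M).
Proof.
exists (Num.max M 1); split; first exact: num_real.
move=> K MK z [zM /andP[z0 z1]].
move: MK; rewrite gt_max => /andP[MK K1]; rewrite /= prod_normE ge_max.
by rewrite (le_trans zM (ltW MK)) ger0_norm// (le_trans z1 (ltW K1)).
Qed.

(** [C] cannot meet both the component of the bottom left corner and that of the
    bottom right corner in the complement of [G], since together with [C] they
    would join left to right off [G]. The side that [C] misses is joined to [G].
    *)
Lemma barrier_side (M : R) (G C : set V) (z0 z1 : V) : 0 <= M ->
  compact G -> connected G -> closed C -> connected C -> C `<=` box M ->
  G `<=` box M `\` C -> G z0 -> z0.2 = 0 -> G z1 -> z1.2 = 1 ->
  connected_component (box M `\` C) (- M, 0) z0 \/
  connected_component (box M `\` C) (M, 0) z0.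
Proof.
move=> M0 cG conG clC conC CB GBC Gz0 z00 Gz1 z11.
have clG := compact_closed (@norm_hausdorff _ _) cG.
have Bl : box M (- M, 0).
  by split; rewrite /strip/= ?normrN ?ger0_norm// lexx ler01.
have Br : box M (M, 0).
  by split; rewrite /strip/= ?ger0_norm// lexx ler01.
pose Vl := connected_component (box M `\` G) (- M, 0) `&` C.
pose Vr := connected_component (box M `\` G) (M, 0) `&` C.
have [Vl0|/set0P[x [lx Cx]]] := eqVneq Vl set0.
  by left; apply: connected_to_barrier Vl0 => //; exact: segment_convex_box.
have [Vr0|/set0P[y [ry Cy]]] := eqVneq Vr set0.
  by right; apply: connected_to_barrier Vr0 => //; exact: segment_convex_box.
exfalso.
have xy : connected_component (box M `\` G) x y.
  exists C => //; split=> // z Cz; split; first exact: CB.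
  by move=> /GBC[_ /(_ Cz)].
have lr := connected_component_trans
  (connected_component_trans lx xy) (connected_component_sym ry).
have [D [cD conD DBG Dl Dr]] :=
  compact_connection (@segment_convex_box M) clG lr.
apply: (@separating_crossing R M G D z1 z0 (- M, 0) (M, 0)) => //.
- exact: compact_closed (@norm_hausdorff _ _) cD.
- by rewrite -subset0 => z [Gz /DBG[_ /(_ Gz)]].
- by move=> z /GBC[[]].
- by move=> z /DBG[[]].
Qed.

End strip.

(** * Crossing components of the complement *)

Lemma continuous_pair (T U W : topologicalType) (f : T -> U) (g : T -> W) :
  continuous f -> continuous g -> continuous (fun x => (f x, g x)).
Proof.
by move=> cf cg x; apply: (@cvg_pair _ _ _ _ (nbhs (f x)) (nbhs (g x)));
  [exact: cf|exact: cg].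
Qed.

Section planar.
Context {R : realType}.
Local Notation V := (R * R)%type.

Definition clamp (M : R) (z : V) : V := (Num.max (- M) (Num.min M z.1), z.2).

Lemma continuous_clamp M : continuous (clamp M).
Proof.
apply: continuous_pair => [z|]; last by move=> z; exact: cvg_snd.
apply: (@continuous_max R V (fun=> - M) (fun z => Num.min M z.1)).
  exact: cvg_cst.
apply: (@continuous_min R V (fun=> M) fst); first exact: cvg_cst.
exact: cvg_fst.
Qed.

Lemma clamp_box M z : 0 <= M -> strip z -> box M (clamp M z).
Proof.
move=> M0 Sz; split=> //=.
by rewrite ler_norml le_max lexx /= ge_max ge_min lexx andbT /=; lra.
Qed.

(** Clamping moves a point horizontally, and only through the part of the strip
    where [X] has no points. *)
Lemma clamp_off M (X : set V) z : 0 <= M -> (forall x, X x -> `|x.1| < M) ->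
  strip z -> ~ X z -> segment z (clamp M z) `<=` strip `\` X.
Proof.
move=> M0 XM Sz nXz w zw.
split; first exact: (segment_convex_strip Sz (clamp_box M0 Sz).2 zw).
have [t [/andP[t0 t1] w1 w2]] := segment_pairP zw.
move=> Xw; have := XM _ Xw; rewrite ltr_norml => /andP[lw rw].
apply: nXz; suff <- : w = z by [].
rewrite [w]surjective_pairing [z]surjective_pairing; congr pair; last first.
  by rewrite w2 /= subrr mulr0 addr0.
move: w1 => /=; have [Mz|zM] := leP M z.1.
  rewrite max_r; last by lra.
  by move=> w1; exfalso; move: rw; rewrite w1; nra.
have [Mz|zM'] := leP (- M) z.1; first by rewrite subrr mulr0 addr0.
by move=> w1; exfalso; move: lw; rewrite w1; nra.
Qed.

(** Clamping a crossing component into the box keeps it within itself, and the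
    result contains a continuum between the two edges. *)
Lemma crossing_representative (M : R) (X D : set V) : 0 <= M ->
  closed X -> (forall x, X x -> `|x.1| < M) ->
  crossing_components (level 0) (level 1) (strip `\` X) D ->
  exists z0 z1 G, [/\ [/\ D z0, z0.2 = 0, z1.2 = 1, G z0 & G z1],
    D = connected_component (strip `\` X) z0,
    compact G, connected G & G `<=` box M `\` X].
Proof.
move=> M0 clX XM [[d [Sd nXd] DE] [p [Dp p0]] [q [Dq q1]]].
have conD : connected D by rewrite -DE; exact: component_connected.
have DSX : D `<=` strip `\` X by rewrite -DE; exact: connected_component_sub.
have clampD z : D z -> D (clamp M z).
  move=> Dz; have [Sz nXz] := DSX z Dz.
  move: (Dz); rewrite -DE => dz; apply: (connected_component_trans dz).
  exact/connected_component_segment/clamp_off.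
have pq : connected_component (box M `\` X) (clamp M p) (clamp M q).
  exists (clamp M @` D); last by exists q.
  split; first by exists p.
    move=> _ [z Dz <-]; have [Sz _] := DSX z Dz; split; first exact: clamp_box.
    by have [] := DSX _ (clampD z Dz).
  apply: connected_continuous_connected => //.
  by apply: continuous_subspaceT; exact: continuous_clamp.
have [G [cG conG GBX Gp Gq]] :=
  compact_connection (@segment_convex_box R M) clX pq.
exists (clamp M p), (clamp M q), G; split=> //.
  by split=> //; exact: clampD.
by rewrite -DE; apply: same_connected_component; rewrite DE; exact: clampD.
Qed.

(** A crossing component [D] of the complement is determined by the set [side D]
    of the crossing components of [X] off which [D] is joined to the left end
    [l]. If [D] is not joined to [l] off [C], it is joined to [r], so two
    components with equal sides always meet at [l] or at [r]; off a component of
    [X] that is not crossing they meet along an edge of the strip. *)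
Lemma finite_crossing_components (X : set V) : compact X -> X `<=` strip ->
  finite_set (crossing_components (level 0) (level 1) X) ->
  finite_set (crossing_components (level 0) (level 1) (strip `\` X)).
Proof.
move=> cX XS finX.
have clX := compact_closed (@norm_hausdorff _ _) cX.
have [M M0 XM] : exists2 M : R, 0 < M & forall x, X x -> `|x.1| < M.
  have [N [Nreal bN]] := compact_bounded cX.
  exists (`|N| + 2); first by rewrite ltr_wpDl.
  move=> x Xx; have : `|x| < `|N| + 2.
    apply: (@le_lt_trans _ _ (`|N| + 1)); last by rewrite ltrD2l ltr1n.
    by apply: bN => //; rewrite (le_lt_trans (ler_norm N))// ltrDl.
  by rewrite norm_pair_lt => /andP[].
have M0' := ltW M0.
pose F := crossing_components (level 0) (level 1) (strip `\` X).
pose l : V := (- M, 0); pose r : V := (M, 0).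
have /choice[rep repP] : forall D, exists z0, F D -> exists z1 G,
    [/\ [/\ D z0, z0.2 = 0, z1.2 = 1, G z0 & G z1],
    D = connected_component (strip `\` X) z0,
    compact G, connected G & G `<=` box M `\` X].
  move=> D; have [FD|nFD] := pselect (F D); last by exists 0.
  by have [z0 z1G] := crossing_representative M0' clX XM FD; exists z0.
pose side D := [set C | crossing_components (level 0) (level 1) X C /\
  connected_component (box M `\` C) l (rep D)].
have sideX D : side D `<=` crossing_components (level 0) (level 1) X.
  by move=> C [].
suff inj D E : F D -> F E -> side D = side E -> D = E.
  have finS : finite_set (side @` F).
    by apply: sub_finite_set (finite_subsets finX) => _ [D _ <-]; exact: sideX.
  have /choice[g gP] : forall C, exists D,
      (side @` F) C -> F D /\ side D = C.
    move=> C.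
    have [[D FD DC]|nC] := pselect ((side @` F) C); last by exists set0.
    by exists D.
  apply: sub_finite_set (finite_image g finS) => D FD.
  have [|FgD gD] := gP (side D); first by exists D.
  by exists (side D); [exists D|exact: inj].
move=> FD FE sDE.
have [p1 [G [[Dp p0 p11 Gp Gp1] DE cG conG GBX]]] := repP D FD.
have [q1 [H [[Eq q0 q11 Hq Hq1] EE cH conH HBX]]] := repP E FE.
set p := rep D in Dp p0 Gp DE; set q := rep E in Eq q0 Hq EE.
have Bp : box M p by have [] := GBX p Gp.
have Bq : box M q by have [] := HBX q Hq.
have XB : X `<=` box M by move=> x Xx; split; [exact/ltW/XM|exact: XS].
suff pq : connected_component (box M `\` X) p q.
  rewrite DE EE; apply: same_connected_component.
  by apply: connected_component_mono pq; apply: setSD => z [].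
apply: connected_off_components => //.
- exact: segment_convex_box.
- exact: bounded_box.
move=> x Xx; set C := connected_component X x.
have CX : C `<=` X by exact: connected_component_sub.
have offC W : W `<=` box M `\` X -> W `<=` box M `\` C.
  by move=> WBX; apply: subset_trans WBX _; exact: setDS.
have joinG y z : G y -> G z -> connected_component (box M `\` C) y z.
  by move=> Gy Gz; exists G => //; split=> //; exact: offC.
have joinH y z : H y -> H z -> connected_component (box M `\` C) y z.
  by move=> Hy Hz; exists H => //; split=> //; exact: offC.
have edge t y z : 0 <= t <= 1 -> C `&` level t = set0 -> box M y -> box M z ->
    y.2 = t -> z.2 = t -> connected_component (box M `\` C) y z.
  move=> t01 Ct By Bz yt zt; apply: connected_component_segment => w yzw.
  split; first exact: (segment_convex_box By Bz yzw).
  move=> Cw; rewrite -[False]/((set0 : set V) w) -Ct; split=> //.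
  have [s [_ _]] := segment_pairP yzw.
  by rewrite yt zt subrr mulr0 addr0.
have [C0|/set0P C0] := eqVneq (C `&` level 0) set0.
  by apply: (edge 0) => //; rewrite lexx ler01.
have [C1|/set0P C1] := eqVneq (C `&` level 1) set0.
  apply: connected_component_trans (joinG _ _ Gp Gp1) _.
  apply: connected_component_trans (joinH _ _ Hq1 Hq).
  apply: (edge 1) => //; first by rewrite lexx ler01.
    by have [] := GBX p1 Gp1.
  by have [] := HBX q1 Hq1.
have CrC : crossing_components (level 0) (level 1) X C by split=> //; exists x.
have side_of (K : set V) (z0 z1 : V) : compact K -> connected K ->
    K `<=` box M `\` X -> K z0 -> z0.2 = 0 -> K z1 -> z1.2 = 1 ->
    connected_component (box M `\` C) l z0 \/
    connected_component (box M `\` C) r z0.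
  move=> cK conK KBX Kz0 z00 Kz1 z11.
  apply: (@barrier_side R M K C z0 z1) => //.
  - exact: component_closed.
  - exact: component_connected.
  - exact: subset_trans XB.
  - exact: offC.
have sideDE : side D C <-> side E C by rewrite sDE.
have [lp|nlp] := pselect (connected_component (box M `\` C) l p).
  have [_ lq] : side E C by apply/sideDE.
  exact: connected_component_trans (connected_component_sym lp) lq.
have nlq : ~ connected_component (box M `\` C) l q.
  by move=> lq; apply: nlp; have [] : side D C by apply/sideDE.
have [//|rp] := side_of G p p1 cG conG GBX Gp p0 Gp1 p11.
have [//|rq] := side_of H q q1 cH conH HBX Hq q0 Hq1 q11.
exact: connected_component_trans (connected_component_sym rp) rq.
Qed.

End planar.

(** * Affine coordinates adapted to two parallel lines *)

Section plane.
Context {R : realType}.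
Implicit Types z w : plane R.

Lemma ReB z w : complex.Re (z - w) = complex.Re z - complex.Re w.
Proof. by case: z w => [a b] [c d]. Qed.

Lemma ImB z w : complex.Im (z - w) = complex.Im z - complex.Im w.
Proof. by case: z w => [a b] [c d]. Qed.

Lemma ImD z w : complex.Im (z + w) = complex.Im z + complex.Im w.
Proof. by case: z w => [a b] [c d]. Qed.

Lemma norm_Re z : `|complex.Re z| <= complex.Re `|z|.
Proof.
by rewrite normc_def /= -sqrtr_sqr ler_wsqrtr// lerDl sqr_ge0.
Qed.

Lemma norm_Im z : `|complex.Im z| <= complex.Re `|z|.
Proof.
by rewrite normc_def /= -sqrtr_sqr ler_wsqrtr// lerDr sqr_ge0.
Qed.

Lemma norm_real_complex z : (complex.Re `|z|)%:C = `|z|.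
Proof. by rewrite RRe_real// normr_real. Qed.

Lemma near_plane (e : R) z : 0 < e ->
  \forall w \near z, complex.Re `|z - w| < e.
Proof.
move=> e0; have ec0 : 0 < e%:C :> plane R by rewrite ltcR.
have : \forall w \near z, `|z - w| < (e%:C : plane R).
  have /cvgrPdist_lt : (fun w : plane R => w) @ z --> z by exact: cvg_id.
  exact.
by apply: filterS => w; rewrite -norm_real_complex ltcR.
Qed.

Lemma continuous_Re : continuous (@complex.Re R : plane R -> R).
Proof.
move=> z; apply/(@cvgrPdist_lt _ _ _ (nbhs z) (nbhs_filter z)) => e e0.
near=> w; rewrite -ReB; apply: le_lt_trans (norm_Re _) _; near: w; exact: near_plane.
Unshelve. all: by end_near.
Qed.

Lemma continuous_Im : continuous (@complex.Im R : plane R -> R).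
Proof.
move=> z; apply/(@cvgrPdist_lt _ _ _ (nbhs z) (nbhs_filter z)) => e e0.
near=> w; rewrite -ImB; apply: le_lt_trans (norm_Im _) _; near: w; exact: near_plane.
Unshelve. all: by end_near.
Qed.

Lemma continuous_real_complex : continuous ((fun x => x%:C) : R -> plane R).
Proof.
move=> x; apply/(@cvgrPdist_lt _ _ _ (nbhs x) (nbhs_filter x)) => e e0.
have eE : (complex.Re e)%:C = e by apply: RRe_real; exact: gtr0_real.
have e0' : 0 < complex.Re e by rewrite -(ltcR 0) eE.
near=> y.
rewrite -rmorphB -norm_real_complex -eE ltcR normc_def /= expr0n addr0 sqrtr_sqr.
by near: y; exact: (@cvgr_dist_lt _ _ _ _ _ id).
Unshelve. all: by end_near.
Qed.

(** Relative to the origin [p], the first unit vector [v] and the second unit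
    vector [q - p], so that the lines through [p] and [q] directed by [v] have
    [height] 0 and 1. *)
Section chart.
Variables p q v : plane R.
Let u z : plane R := (z - p) / v.
Let k : plane R := (q - p) / v.

Definition height z : R := complex.Im (u z) / complex.Im k.

Definition chart z : R * R :=
  (complex.Re (u z) - height z * complex.Re k, height z).

Definition unchart (x : R * R) : plane R :=
  p + v * (x.1%:C + x.2%:C * k).

Lemma continuous_quot : continuous u.
Proof.
move=> z; apply: (@cvgMr_tmp (plane R) _ (nbhs z) _ (fun z => z - p)).
by apply: (@cvgB (plane R) (plane R)); [exact: cvg_id|exact: cvg_cst].
Qed.

Lemma continuous_height : continuous height.
Proof.
move=> z; apply: (@cvgMr_tmp R _ (nbhs z) _ (fun z => complex.Im (u z))).
apply: (@continuous_comp _ _ _ u (@complex.Im R)); first exact: continuous_quot.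
exact: continuous_Im.
Qed.

Lemma continuous_chart : continuous chart.
Proof.
apply: continuous_pair => [z|]; last exact: continuous_height.
apply: (@cvgB R R _ (nbhs z) _ (fun z => complex.Re (u z))); last first.
  apply: (@cvgMr_tmp R _ (nbhs z) _ height); exact: continuous_height.
apply: (@continuous_comp _ _ _ u (@complex.Re R)); first exact: continuous_quot.
exact: continuous_Re.
Qed.

Lemma continuous_unchart : continuous unchart.
Proof.
move=> x; apply: (@cvgD (plane R) (plane R)); first exact: cvg_cst.
apply: (@cvgMl_tmp (plane R)); apply: (@cvgD (plane R) (plane R)).
  apply: (@continuous_comp _ _ _ (fst : R * R -> R) (fun x => x%:C : plane R)).
    exact: cvg_fst.
  exact: continuous_real_complex.
apply: (@cvgMr_tmp (plane R) _ (nbhs x) _ (fun x : R * R => x.2%:C)).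
apply: (@continuous_comp _ _ _ (snd : R * R -> R) (fun x => x%:C : plane R)).
  exact: cvg_snd.
exact: continuous_real_complex.
Qed.

Hypotheses (v0 : v != 0) (k0 : complex.Im k != 0).

Lemma chartK : cancel chart unchart.
Proof.
move=> z; rewrite /unchart /= /height.
suff -> : (complex.Re (u z) - complex.Im (u z) / complex.Im k * complex.Re k)%:C
    + (complex.Im (u z) / complex.Im k)%:C * k = u z.
  by rewrite /u mulrC divfK// subrKC.
move: (u z) k k0 => [a b] [c d] /= d0.
apply/eqP; rewrite eq_complex /= !(mul0r, subr0, addr0, add0r) subrK divfK//.
by rewrite !eqxx.
Qed.

Lemma unchartK : cancel unchart chart.
Proof.
move=> [s t]; rewrite /chart /height.
have -> : u (unchart (s, t)) = s%:C + t%:C * k.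
  by rewrite /u /unchart addrC addKr mulrC mulKf.
move: k k0 => [c d] /= d0; rewrite !(mul0r, subr0, addr0, add0r) mulfK//.
by rewrite addrK.
Qed.

Lemma height_line1 z : line p v z <-> height z = 0.
Proof.
split=> [[t _ <-]|].
  by rewrite /height /u addrC addKr mulfK//= mul0r.
move=> /eqP; rewrite mulf_eq0 invr_eq0 (negbTE k0) orbF => /eqP Imu.
exists (complex.Re (u z)) => //.
have -> : (complex.Re (u z))%:C = u z by case: (u z) Imu => a b /= ->.
by rewrite /u divfK// subrKC.
Qed.

Lemma height_line2 z : line q v z <-> height z = 1.
Proof.
have kv : k * v = q - p by rewrite /k /u divfK.
split=> [[t _ <-]|].
  have -> : height (q + t%:C * v) = complex.Im (t%:C + k) / complex.Im k.
    rewrite /height; congr (complex.Im _ / _).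
    by rewrite /u addrAC mulrDl mulfK//; exact: addrC.
  by rewrite ImD /= add0r divff.
move=> /(congr1 ( *%R^~ (complex.Im k))); rewrite mul1r divfK// => Imu.
exists (complex.Re (u z - k)) => //.
have -> : (complex.Re (u z - k))%:C = u z - k.
  have := ImB (u z) k; rewrite Imu subrr.
  by case: (u z - k) => a b /= ->.
by rewrite mulrBl kv /u divfK// opprB subrKA subrKC.
Qed.

Lemma height_dist z w :
  `|height z - height w| * complex.Re `|v| * `|complex.Im k| <=
  complex.Re `|z - w|.
Proof.
rewrite /height -mulrBl -ImB normrM normfV mulrAC.
rewrite divfK ?normr_eq0//.
apply: (@le_trans _ _ (complex.Re `|u z - u w| * complex.Re `|v|)).
  rewrite ler_wpM2r ?norm_Im//; exact: le_trans (norm_Re v).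
rewrite -lecR rmorphM /= !norm_real_complex -normrM /u -mulrBl divfK//.
by rewrite opprB addrA subrK.
Qed.

End chart.
End plane.

(** * Crossing components of locally connected and finitely Suslinian sets *)

Section transfer.
Context {T U : topologicalType} (f : T -> U) (g : U -> T).
Hypotheses (fK : cancel f g) (cf : continuous f) (cg : continuous g).

Lemma image_connected_component A x :
  f @` connected_component A x = connected_component (f @` A) (f x).
Proof.
apply/seteqP; split=> [_ [y [W [Wx WA cW] Wy] <-]|y [W [Wx WA cW] Wy]].
  exists (f @` W); last by exists y.
  split; [by exists x|exact: image_subset|].
  by apply: connected_continuous_connected => //; exact: continuous_subspaceT.
have [a Aa ay] := WA y Wy; exists a => //.
exists (g @` W); last by exists y => //; rewrite -ay fK.
split; first by exists (f x).
  by move=> _ [w Ww <-]; have [b Ab <-] := WA w Ww; rewrite fK.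
by apply: connected_continuous_connected => //; exact: continuous_subspaceT.
Qed.

Lemma finite_crossing_components_image (P Q A : set T) (P' Q' : set U) :
  (forall x, P x -> P' (f x)) -> (forall x, Q x -> Q' (f x)) ->
  finite_set (crossing_components P' Q' (f @` A)) ->
  finite_set (crossing_components P Q A).
Proof.
move=> PP' QQ' fin.
apply: sub_finite_set (finite_image (image^~ g) fin) => D [[x Ax <-] DP DQ].
exists (f @` connected_component A x); last first.
  by apply/seteqP; split=> [_ [_ [y Dy <-] <-]|y Dy];
    [rewrite fK|exists (f y); [exists y|rewrite fK]].
split.
- by rewrite image_connected_component; exists (f x) => //; exists x.
- by have [y [Dy Py]] := DP; exists (f y); split; [exists y|exact: PP'].
- by have [y [Dy Qy]] := DQ; exists (f y); split; [exists y|exact: QQ'].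
Qed.

End transfer.

Lemma connected_level (T : topologicalType) (R : realType) (h : T -> R)
    (D : set T) (a b : T) (t : R) : continuous h -> connected D ->
  D a -> D b -> h a <= t <= h b -> exists2 c, D c & h c = t.
Proof.
move=> ch cD Da Db ht.
have itv : is_interval (h @` D).
  apply/connected_intervalP/connected_continuous_connected => //.
  exact: continuous_subspaceT.
have [||c Dc <-] := itv (h a) (h b) _ _ t ht; [by exists a|by exists b|].
by exists c.
Qed.

(** Near a point of [K] at height 1/2, local connectedness gives a connected
    trace of [K] inside the strip, hence inside one component; the set of these
    points is compact, and every crossing component contains one. *)
Lemma locally_connected_crossing (T : ptopologicalType) (R : realType)
    (h : T -> R) (K : set T) :
  continuous h -> compact K -> locally_connected K ->
  finite_set (crossing_components [set x | h x = 0] [set x | h x = 1]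
    (K `&` [set x | 0 <= h x <= 1])).
Proof.
move=> ch cK lcK; set X := K `&` _.
pose middle := K `&` [set x | h x = 2^-1].
pose P (A : set T) := finite_set [set D | components X D /\ D `&` A !=set0].
suff : P middle.
  apply: sub_finite_set => D [XD [a [Da h0]] [b [Db h1]]]; split=> //.
  have [x Xx DE] := XD; have conD : connected D.
    by rewrite -DE; exact: component_connected.
  have [|c Dc hc] := connected_level (t := 2^-1) ch conD Da Db.
    by rewrite h0 h1; lra.
  exists c; split=> //; split=> //.
  by move: Dc; rewrite -DE => /connected_component_sub[].
have cmid : compact middle.
  apply: compact_closedI => //.
  by apply: (@preimage_closed _ _ h [set 2^-1]) => // x _; exact: ch.
apply: (compact_ind cmid).
- apply: (@sub_finite_set _ _ set0) => // D [_ [x []]//].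
- move=> A B PA PB; have : finite_set (
      [set D | components X D /\ D `&` A !=set0] `|`
      [set D | components X D /\ D `&` B !=set0]) by rewrite finite_setU.
  apply: sub_finite_set.
  by move=> D [XD [x [Dx [Ax|Bx]]]]; [left|right]; split=> //; exists x.
- move=> x [Kx hx].
  pose W := [set y | 0 < h y] `&` [set y | h y < 1].
  have oW : open W.
    move/continuousP: ch => oh.
    apply: openI; first by apply: (oh [set r | 0 < r]); exact: open_gt.
    by apply: (oh [set r | r < 1]); exact: open_lt.
  have Wx : W x by rewrite /W /= hx; split; lra.
  have [N [oN Nx cN NW]] := lcK x W Kx oW Wx.
  exists N; split=> //.
  apply: (@sub_finite_set _ _ [set connected_component X x]) => //.
  move=> D [[y Xy <-] [z [yz [[Kz hz] Nz]]]] /=.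
  rewrite (same_connected_component yz); apply: same_connected_component.
  exists (N `&` K) => //; split=> // w [Nw Kw]; split=> //=.
  by have [] := NW w (conj Nw Kw) => /= w0 w1; rewrite !ltW.
Qed.

Section main.
Context {R : realType}.
Implicit Types (K A U : set (plane R)) (x y z p q v : plane R).

Lemma diameter_ge K A x y : compact K -> A `<=` K -> A x -> A y ->
  complex.Re `|x - y| <= diameter A.
Proof.
move=> cK AK Ax Ay; apply: ub_le_sup; last by exists x => //; exists y.
have : has_ubound ((@complex.Re R : plane R -> R) @`
    ((fun z : plane R * plane R => `|z.1 - z.2|) @` (K `*` K))).
  have : compact ((@complex.Re R : plane R -> R) @`
    ((fun z : plane R * plane R => `|z.1 - z.2|) @` (K `*` K))).
    apply: continuous_compact.
      by apply: continuous_subspaceT; exact: continuous_Re.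
    apply: continuous_compact; last exact: compact_setX.
    apply: continuous_subspaceT => z; apply: (@cvg_norm (plane R) (plane R)).
    by apply: (@cvgB (plane R) (plane R)); [exact: cvg_fst|exact: cvg_snd].
  move=> /compact_bounded [M [Mreal bM]]; exists (M + 1) => r /bM.
  by move=> /(_ (M + 1)) h; apply: le_trans (ler_norm r) (h _); rewrite ltrDl.
move=> [M uM]; exists M => _ [a Aa [b Ab <-]].
by apply: uM; exists `|a - b| => //; exists (a, b) => //=; split; exact: AK.
Qed.

Lemma closed_strip p q v : closed [set z | 0 <= height p q v z <= 1].
Proof.
have /continuous_closedP ch := @continuous_height R p q v.
rewrite (_ : [set _ | _] = height p q v @^-1` `[0, 1]%classic).
  by apply: ch; exact: itv_closed.
by apply/seteqP; split=> z; rewrite /= in_itv.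
Qed.

Lemma finitely_suslinian_crossing K p q v :
  v != 0 -> complex.Im ((q - p) / v) != 0 -> compact K ->
  finitely_suslinian K ->
  finite_set (crossing_components [set z | height p q v z = 0]
    [set z | height p q v z = 1] (K `&` [set z | 0 <= height p q v z <= 1])).
Proof.
move=> v0 k0 cK; apply.
- move=> _ [[x Xx <-] _ _]; set X := K `&` _ in Xx *.
  have XK : X `<=` K by move=> z [].
  have clX : closed X.
    apply: closedI.
      exact: compact_closed (@norm_hausdorff _ (plane R)) cK.
    exact: closed_strip.
  split; last by move=> z /connected_component_sub/XK.
  split.
  + by exists x; exact: connected_component_refl.
  + apply: (subclosed_compact _ cK); first exact: component_closed.
    by move=> z /connected_component_sub/XK.
  + exact: component_connected.
- move=> A B [[x _ <-] _ _] [[y _ <-] _ _] AB; rewrite -subset0 => z [xz yz].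
  apply: AB; rewrite (same_connected_component xz).
  by rewrite (same_connected_component yz).
- exists (complex.Re `|v| * `|complex.Im ((q - p) / v)|).
    rewrite mulr_gt0 ?normr_gt0//.
    by rewrite -(ltcR 0) norm_real_complex normr_gt0.
  move=> D [[x Xx DE] [a [Da ha]] [b [Db hb]]].
  apply: le_trans (diameter_ge cK _ Da Db); last first.
    by rewrite -DE => z /connected_component_sub[].
  apply: le_trans (height_dist v0 k0 a b).
  by rewrite ha hb sub0r normrN1 mul1r.
Qed.

(** A connected set off the two lines must lie between them if its closure
    contains both, and the open region between them is connected. *)
Lemma closure_strip p q v U :
  v != 0 -> complex.Im ((q - p) / v) != 0 ->
  is_strip (line p v) (line q v) U ->
  closure U = [set z | 0 <= height p q v z <= 1].
Proof.
move=> v0 k0 [[u nLu UE] bU].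
pose h := height p q v.
have L1P z : line p v z <-> h z = 0 by exact: height_line1.
have L2P z : line q v z <-> h z = 1 by exact: height_line2.
have ch : continuous h by exact: continuous_height.
have clsub C : closed C -> U `<=` C -> closure U `<=` C.
  by move=> /closure_id clC UC; rewrite clC; exact: closureS.
have /continuous_closedP closed_h := ch.
have LclU z : (line p v `|` line q v) z -> closure U z.
  by rewrite -bU => -[].
have Lp : closure U p.
  by apply: LclU; left; apply/L1P; rewrite /h /height subrr mul0r mul0r.
have Lq : closure U q.
  by apply: LclU; right; apply/L2P; rewrite /h /height divff.
have hp : h p = 0 by rewrite /h /height subrr !mul0r.
have hq : h q = 1 by rewrite /h /height divff.
have Uoff z : U z -> h z <> 0 /\ h z <> 1.
  rewrite -UE => /connected_component_sub nL.
  by split=> hz; apply: nL; [left; apply/L1P|right; apply/L2P].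
have conU : connected U by rewrite -UE; exact: component_connected.
have Uu : U u.
  by rewrite -UE; exact: connected_component_refl.
have Uopen z : U z -> 0 < h z < 1.
  move=> Uz; have [hz0 hz1] := Uoff z Uz.
  apply/andP; split; rewrite ltNge; apply/negP => hz.
    have /clsub : U `<=` h @^-1` [set r | r <= 0].
      move=> w Uw; rewrite /= leNgt; apply/negP => hw.
      have [|c Uc hc] := connected_level (t := 0) ch conU Uz Uw.
        by rewrite hz ltW.
      by have [] := Uoff c Uc.
    move=> /(_ (closed_h _ (@closed_le _ 0)))/(_ q Lq) /=.
    by rewrite hq ler10.
  have /clsub : U `<=` h @^-1` [set r | 1 <= r].
    move=> w Uw; rewrite /= leNgt; apply/negP => hw.
    have [|c Uc hc] := connected_level (t := 1) ch conU Uw Uz.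
      by rewrite hz ltW.
    by have [] := Uoff c Uc.
  move=> /(_ (closed_h _ (@closed_ge _ 1)))/(_ p Lp) /=.
  by rewrite hp ler10.
apply/seteqP; split.
  apply: clsub; first exact: closed_strip.
  by move=> z /Uopen/andP[z0 z1]; rewrite /= !ltW.
move=> z /= /andP[z0 z1].
have [hz|hz0] := eqVneq (h z) 0; first by apply: LclU; left; apply/L1P.
have [hz|hz1] := eqVneq (h z) 1; first by apply: LclU; right; apply/L2P.
have {}z0 : 0 < h z by rewrite lt_def hz0.
have {}z1 : h z < 1 by rewrite lt_def eq_sym hz1.
apply: subset_closure; rewrite -UE.
exists (unchart p q v @` segment (chart p q v u) (chart p q v z)); last first.
  by exists (chart p q v z); [exact: segment_right|exact: chartK].
split.
- by exists (chart p q v u); [exact: segment_left|exact: chartK].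
- move=> _ [s /segment_pairP[t [/andP[t0 t1] _ /= s2]] <-].
  have hs : h (unchart p q v s) = s.2.
    by rewrite -[in RHS](unchartK v0 k0 s).
  have /andP[u0 u1] := Uopen u Uu; rewrite -/h in s2.
  have s01 : 0 < s.2 < 1.
    by rewrite s2; have [uz|zu] := leP (h u) (h z); apply/andP; split; nra.
  by move=> [/L1P|/L2P]; rewrite hs => s2E; rewrite s2E ?ltxx ?andbF in s01.
- apply: connected_continuous_connected; first exact: segment_is_connected.
  by apply: continuous_subspaceT; exact: continuous_unchart.
Qed.

End main.

Theorem theorem1 (R : realType) (K : set (plane R)) :
  compact K -> locally_connected K \/ finitely_suslinian K -> schonflies K.
Proof.
move=> cK HK _ _ U [p [q [v [v0 -> ->]]]] L12 strU.
have k0 : complex.Im ((q - p) / v) != 0.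
  apply/eqP => k0; apply: L12.
  pose t := complex.Re ((q - p) / v).
  have qE : q = p + t%:C * v.
    have -> : t%:C = (q - p) / v.
      by rewrite /t; case: ((q - p) / v) k0 => a b /= ->.
    by rewrite divfK// subrKC.
  apply/seteqP; split=> _ [s _ <-].
    exists (s - t) => //; rewrite qE rmorphB mulrBl /=; ring.
  by exists (t + s) => //; rewrite qE rmorphD /= mulrDl addrA.
have clU := closure_strip v0 k0 strU.
have cf := @continuous_chart R p q v.
have cg := @continuous_unchart R p q v.
have fK := chartK v0 k0; have gK := unchartK v0 k0.
pose S := [set z | 0 <= height p q v z <= 1].
have clK : closed K := compact_closed (@norm_hausdorff _ (plane R)) cK.
have clS : closed S by exact: closed_strip.
have fin1 : finite_set (crossing_components [set z | height p q v z = 0]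
    [set z | height p q v z = 1] (K `&` S)).
  case: HK => [lcK|fsK]; last exact: finitely_suslinian_crossing.
  by apply: locally_connected_crossing => //; exact: continuous_height.
pose X := chart p q v @` (K `&` S).
have cX : compact X.
  apply: continuous_compact; first exact: continuous_subspaceT.
  apply: subclosed_compact cK _; first exact: closedI.
  by move=> z [].
have XS : X `<=` strip by move=> _ [z [_ Sz] <-].
have gX : unchart p q v @` X = K `&` S.
  by apply/seteqP; split=> [_ [_ [z KSz <-] <-]|z KSz];
    [rewrite fK|exists (chart p q v z); [exists z|rewrite fK]].
have hg s : height p q v (unchart p q v s) = s.2 by rewrite -[in RHS](gK s).
have finX : finite_set (crossing_components (level 0) (level 1) X).
  apply: (finite_crossing_components_image gK cg cf) => [s|s|]; last first.
  - by rewrite gX; exact: fin1.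
  - by rewrite /= hg.
  - by rewrite /= hg.
have := finite_crossing_components cX XS finX.
have -> : strip `\` X = chart p q v @` (S `\` K).
  apply/seteqP; split=> [s [Ss nXs]|_ [z [Sz nKz] <-]].
    exists (unchart p q v s) => //; split; first by rewrite /S /= hg.
    move=> Ks; apply: nXs; exists (unchart p q v s) => //.
    by split=> //; rewrite /S /= hg.
  by split=> // -[w [Kw _] /(can_inj fK) wz]; apply: nKz; rewrite -wz.
rewrite /S -clU.
apply: (finite_crossing_components_image fK cf cg) => z.
  by move=> /(height_line1 v0 k0).
by move=> /(height_line2 v0 k0).
Qed.
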